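(* Let $\varepsilon_0\in\mathbb{R}$ and let $f:\mathbb{R}\times\mathbb{R}^n\times\mathbb{R}\to\mathbb{R}^n$ satisfy, for some $L_f>0$, $$\|f(t_1,x_1,\varepsilon)-f(t_2,x_2,\varepsilon)\|\le L_f|t_1-t_2|+L_f\|x_1-x_2\|\quad\text{for all } t_1,t_2\in\mathbb{R},\ x_1,x_2\in\mathbb{R}^n,\ \varepsilon\in\mathbb{R},$$ and, for some $\alpha>0$, $$\langle f(t,x_1,\varepsilon_0)-f(t,x_2,\varepsilon_0),x_1-x_2\rangle\ge\alpha\|x_1-x_2\|^2\quad\text{for all } t\in\mathbb{R},\ x_1,x_2\in\mathbb{R}^n.$$ Assume that, for every $t\in\mathbb{R}$, the set $C(t)\subset\mathbb{R}^n$ is nonempty, closed and convex, that the map $t\mapsto C(t)$ is uniformly bounded (there is $M>0$ with $\|c\|\le M$ for all $c\in C(t)$, $t\in\mathbb{R}$), and that for some $L_C>0$ one has $d_H(C(t_1),C(t_2))\le L_C|t_1-t_2|$ for all $t_1,t_2\in\mathbb{R}$. Finally, assume that $f(t,x,\varepsilon)$ is continuous at $\varepsilon=\varepsilon_0$ uniformly in $t\in\mathbb{R}$, $x\in\mathbb{R}^n$. Consider the sweeping process $$-\dot x(t)\in N_{C(t)}(x(t))+f(t,x(t),\varepsilon),\qquad(\mathrm{SP}_\varepsilon)$$ and let $x_0:\mathbb{R}\to\mathbb{R}^n$ be the unique solution of $(\mathrm{SP}_{\varepsilon_0})$ defined on the entire $\mathbb{R}$. Then for every $\gamma>0$ there exists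 $t_1\ge0$ such that for all $\varepsilon$ sufficiently close to $\varepsilon_0$ and every solution $x_\varepsilon$ of $(\mathrm{SP}_\varepsilon)$ defined on $[0,\infty)$ one has $$\|x_\varepsilon(t)-x_0(t)\|<\gamma\quad\text{for all } t\ge t_1.$$
   Context: For a closed convex set $C\subset\mathbb{R}^n$, the outward normal cone is $N_C(x)=\{\xi\in\mathbb{R}^n:\langle\xi,c-x\rangle\le 0\text{ for all }c\in C\}$ if $x\in C$ and $N_C(x)=\emptyset$ if $x\notin C$. The Hausdorff distance between closed sets is $d_H(C_1,C_2)=\max\{\sup_{x\in C_2}\mathrm{dist}(x,C_1),\sup_{x\in C_1}\mathrm{dist}(x,C_2)\}$ with $\mathrm{dist}(x,C)=\inf\{\|x-c\|:c\in C\}$. A solution of a sweeping process on an interval $I\subseteq\mathbb{R}$ is a function $x:I\to\mathbb{R}^n$, absolutely continuous on every compact subinterval of $I$, with $x(t)\in C(t)$ for all $t\in I$, that satisfies the inclusion for almost every $t\in I$. Under the stated hypotheses $(\mathrm{SP}_{\varepsilon_0})$ has exactly one solution defined on the entire $\mathbb{R}$. *)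

(* Defs.v *)
(* R^n is rendered as row vectors over an abstract R : realType. *)
From HB Require Import structures.
From mathcomp Require Export all_boot all_order all_algebra.
From mathcomp Require Export all_classical all_reals all_analysis.
Export Order.TTheory GRing.Theory Num.Theory.
Export numFieldNormedType.Exports.

Set Implicit Arguments.
Unset Strict Implicit.
Unset Printing Implicit Defensive.

Local Open Scope classical_set_scope.
Local Open Scope ring_scope.

Definition dotp (R : realType) (n : nat) (u v : 'rV[R]_n) : R :=
  \sum_(i < n) u 0 i * v 0 i.

(* The library norm `|u| on 'rV[R]_n is the sup norm. It induces the same
   topology and derivatives as the Euclidean norm, but estimates in R^n are
   stated with the latter. *)
Definition enorm (R : realType) (n : nat) (u : 'rV[R]_n) : R :=
  Num.sqrt (dotp u u).

Definition dist (R : realType) (n : nat) (x : 'rV[R]_n) (A : set 'rV[R]_n) :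
    \bar R :=
  ereal_inf [set (enorm (x - c))%:E | c in A].

Definition hausdorff_dist (R : realType) (n : nat) (A B : set 'rV[R]_n) :
    \bar R :=
  maxe (ereal_sup [set dist x A | x in B]) (ereal_sup [set dist x B | x in A]).

Definition normal_cone (R : realType) (n : nat) (A : set 'rV[R]_n)
    (x : 'rV[R]_n) : set 'rV[R]_n :=
  [set xi | A x /\ forall c, A c -> dotp xi (c - x) <= 0].

Definition absolutely_continuous (R : realType) (n : nat) (a b : R)
    (x : R -> 'rV[R]_n) : Prop :=
  forall e : R, 0 < e -> exists2 d : R, 0 < d &
    forall (m : nat) (u v : 'I_m -> R),
      (forall i, a <= u i /\ u i <= v i /\ v i <= b) ->
      trivIset setT (fun i => [set` `]u i, v i[]) ->
      \sum_(i < m) (v i - u i) < d ->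
      \sum_(i < m) enorm (x (v i) - x (u i)) < e.

(* x is a solution of  - x'(t) \in N_(C t) (x t) + g t (x t)  on the interval I;
   the values of x outside I play no role, since the endpoints of I, where the
   two-sided derivative could see them, form a null set. *)
Definition sweeping_solution (R : realType) (n : nat)
    (C : R -> set 'rV[R]_n) (g : R -> 'rV[R]_n -> 'rV[R]_n)
    (I : set R) (x : R -> 'rV[R]_n) : Prop :=
  [/\ forall a b : R, a <= b -> `[a, b] `<=` I -> absolutely_continuous a b x,
      forall t : R, I t -> C t (x t) &
      {ae (@lebesgue_measure R), forall t : R, I t ->
        derivable x t 1 /\
        [set xi + g t (x t) | xi in normal_cone (C t) (x t)] (- derive1 x t)}].

(* Main.v *)
(* Let V(t) = |x_eps(t) - x_0(t)|^2. Normal cones are monotone and f(., ., eps0)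
   is strongly monotone, so V' <= -2 alpha V + 4 M eta almost everywhere, where
   eta bounds |f(., ., eps) - f(., ., eps0)| and 2 M bounds |x_eps - x_0|. For
   small eta this gives V' <= -r < 0 wherever V > gamma^2 / 2. As V is
   absolutely continuous and at most 4 M^2, it drops to gamma^2 / 2 before time
   4 M^2 / r + 1 and cannot exceed that level again. *)
Require Import Defs.
From mathcomp Require Import measurable_realfun ring lra.

Set Implicit Arguments.
Unset Strict Implicit.
Unset Printing Implicit Defensive.

Local Open Scope classical_set_scope.
Local Open Scope ring_scope.

(** * Euclidean inner product and norm *)

Section euclidean.
Variables (R : realType) (n : nat).
Implicit Types (a : R) (u v w : 'rV[R]_n).

Lemma dotpC u v : dotp u v = dotp v u.
Proof. by apply: eq_bigr => i _; rewrite mulrC. Qed.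

Lemma dotpDl u v w : dotp (u + v) w = dotp u w + dotp v w.
Proof. by rewrite -big_split; apply: eq_bigr => i _; rewrite mxE mulrDl. Qed.

Lemma dotpZl a u w : dotp (a *: u) w = a * dotp u w.
Proof.
by rewrite /dotp mulr_sumr; apply: eq_bigr => i _; rewrite mxE mulrA.
Qed.

Lemma dotpNl u w : dotp (- u) w = - dotp u w.
Proof. by rewrite -scaleN1r dotpZl mulN1r. Qed.

Lemma dotpDr u v w : dotp w (u + v) = dotp w u + dotp w v.
Proof. by rewrite dotpC dotpDl !(dotpC w). Qed.

Lemma dotpZr a u w : dotp w (a *: u) = a * dotp w u.
Proof. by rewrite dotpC dotpZl dotpC. Qed.

Lemma dotpNr u w : dotp w (- u) = - dotp w u.
Proof. by rewrite dotpC dotpNl dotpC. Qed.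

Definition dotpE := (dotpDl, dotpDr, dotpNl, dotpNr, dotpZl, dotpZr).

Lemma dotp_ge0 u : 0 <= dotp u u.
Proof. by apply: sumr_ge0 => i _; rewrite -expr2 sqr_ge0. Qed.

Lemma sqr_enorm u : enorm u ^+ 2 = dotp u u.
Proof. by rewrite sqr_sqrtr // dotp_ge0. Qed.

Lemma enorm_ge0 u : 0 <= enorm u.
Proof. exact: sqrtr_ge0. Qed.

Lemma enormN u : enorm (- u) = enorm u.
Proof. by rewrite /enorm !dotpE opprK. Qed.

Lemma enorm_eq0 u : enorm u = 0 -> u = 0.
Proof.
move=> u0; have /eqP := sqr_enorm u; rewrite u0 expr0n eq_sym.
rewrite psumr_eq0 => [/allP u00|i _]; last by rewrite -expr2 sqr_ge0.
apply/rowP => i; rewrite mxE; apply/eqP; rewrite -sqrf_eq0 expr2.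
by apply: u00; rewrite mem_index_enum.
Qed.

(** Cauchy-Schwarz: expanding the square of [enorm v *: u - enorm u *: v] gives the claim multiplied
    by [2 * enorm u * enorm v], so zero vectors are treated apart. *)
Lemma dotp_le u v : dotp u v <= enorm u * enorm v.
Proof.
have dotp0 w : dotp 0 w = 0 by rewrite -(scale0r 0) dotpZl mul0r.
have := enorm_ge0 u; rewrite le_eqVlt => /predU1P[u0|u0].
  by rewrite -u0 mul0r (enorm_eq0 (esym u0)) dotp0.
have := enorm_ge0 v; rewrite le_eqVlt => /predU1P[v0|v0].
  by rewrite -v0 mulr0 (enorm_eq0 (esym v0)) dotpC dotp0.
rewrite -subr_ge0 -(pmulr_rge0 _ (mulr_gt0 u0 v0)).
have := dotp_ge0 (enorm v *: u - enorm u *: v).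
rewrite !dotpE -!sqr_enorm (dotpC v u); nra.
Qed.

Lemma enormD u v : enorm (u + v) <= enorm u + enorm v.
Proof.
rewrite -(ler_pXn2r (n := 2)) ?nnegrE ?addr_ge0 ?enorm_ge0 // sqr_enorm.
rewrite !dotpE (dotpC v u) -!sqr_enorm.
by have := dotp_le u v; nra.
Qed.

Lemma enormB u v : enorm (u - v) <= enorm u + enorm v.
Proof. by rewrite -(enormN v) enormD. Qed.

(** The squared norm is polynomial in the coordinates, so the product rule covers it even where [x]
    vanishes. *)
Lemma is_derive_sqr_enorm (x : R -> 'rV[R]_n) (t : R) : derivable x t 1 ->
  is_derive t 1 (fun s => enorm (x s) ^+ 2) (2 * dotp (derive1 x t) (x t)).
Proof.
move=> dx; have /derivable_mxP dxi := dx.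
have -> : (fun s => enorm (x s) ^+ 2) =
    \sum_(i < n) ((fun s => x s 0 i) * (fun s => x s 0 i)).
  by apply/funext => s; rewrite sqr_enorm fct_sumE.
rewrite derive1E derive_mx // /dotp mulr_sumr.
apply: is_derive_eq.
  apply: is_derive_sum => i; apply: is_deriveM; exact/derivableP/dxi.
by apply: eq_bigr => i _; rewrite !mxE; rewrite /GRing.scale /=; ring.
Qed.

End euclidean.

(** * Decrease of absolutely continuous functions from derivative bounds almost everywhere *)

Section absolutely_continuous_decrease.
Variable R : realType.
Implicit Types (F : R -> R) (a b r e t : R).

Definition real_absolutely_continuous a b F :=
  forall e, 0 < e -> exists2 d : R, 0 < d &
    forall (m : nat) (u v : 'I_m -> R),
      (forall i, a <= u i /\ u i <= v i /\ v i <= b) ->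
      trivIset setT (fun i => [set` `]u i, v i[]) ->
      \sum_(i < m) (v i - u i) < d ->
      \sum_(i < m) `|F (v i) - F (u i)| < e.

(* P propagates across a neighbourhood of every point, so sup {t | P t} is b.
   This replaces the choice of a gauge-fine partition of [a, b]. *)
Lemma real_induction (P : R -> Prop) a b : a <= b -> P a ->
  (forall t, a <= t <= b -> exists2 d : R, 0 < d &
    forall u v, a <= u -> v <= b ->
      t - d < u -> u <= t -> t <= v -> v < t + d -> P u -> P v) -> P b.
Proof.
move=> ab Pa Pstep; pose A := [set t | a <= t <= b /\ P t].
have Aa : A a by split=> //; rewrite lexx ab.
have supA : has_sup A by split; [exists a|exists b => t [/andP[]]].
have [aS Sb] : a <= sup A /\ sup A <= b.
  split; first by apply: sup_ubound => //; exact: supA.2.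
  by apply: sup_le_ub; [exists a|move=> t [/andP[]]].
have [|d d0 step] := Pstep (sup A); first by rewrite aS Sb.
have [t [/andP[a_t tb] Pt] St] := sup_adherent d0 supA.
have tS : t <= sup A.
  by apply: sup_ubound => //; [exact: supA.2|rewrite /A /= a_t tb].
(* Stepping from [t], just below the supremum, to [w] puts [w] in [A]. Hence [w <= sup A], which
   excludes [sup A + d / 2] and leaves [w = b]. *)
pose w := Num.min b (sup A + d / 2).
have Sw : sup A <= w by rewrite /w le_min Sb /=; lra.
have Pw : P w.
  apply: (step t w) => //; first by rewrite /w ge_min lexx.
  by rewrite /w gt_min; apply/orP; right; lra.
have : w <= sup A.
  apply: sup_ubound; first exact: supA.2.
  by split=> //; rewrite (le_trans aS Sw) /w ge_min lexx.
by move: Pw; rewrite /w; case: (leP b) => // _ _ ?; exfalso; lra.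
Qed.

(** The straddle lemma of gauge integration: [t] lies between [u] and [v], so the increment splits
    at [t] into two differences, each governed by a difference quotient based at [t] and within [e]
    of [df]. *)
Lemma is_derive_straddle F t df r e :
  is_derive t 1 F df -> df <= - r -> 0 < e ->
  exists2 d : R, 0 < d &
    forall u v, t - d < u -> u <= t -> t <= v -> v < t + d ->
      F v - F u <= (e - r) * (v - u).
Proof.
move=> [Fd Fdf] dfr e0.
have : h^-1 *: (F (h *: 1 + t) - F t) @[h --> 0^'] --> df by rewrite -Fdf.
move=> /cvgrPdist_lt/(_ e e0)/nbhs_ballP[d /= d0 Fnear].
exists d => // u v tu ut tv vt.
have near h : h != 0 -> `|h| < d -> `|df - h^-1 * (F (h + t) - F t)| < e.
  move=> h0 hd; have := Fnear h.
  rewrite -ball_normE /ball_ /= sub0r normrN => /(_ hd h0).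
  by rewrite /GRing.scale /= mulr1.
have right : F v - F t <= (e - r) * (v - t).
  have [->|vt0] := eqVneq v t; first by rewrite !subrr mulr0.
  have v0 : 0 < v - t by rewrite subr_gt0 lt_neqAle eq_sym vt0.
  have := near (v - t); rewrite subrK gt_eqF // gtr0_norm // => /(_ isT).
  move=> /(_ ltac:(lra)); rewrite ltr_norml => /andP[+ _].
  set q := _^-1 * _ => qe; have -> : F v - F t = q * (v - t).
    by rewrite /q mulrAC mulVf ?mul1r // gt_eqF.
  by rewrite ler_pM2r //; lra.
have left : F t - F u <= (e - r) * (t - u).
  have [->|ut0] := eqVneq u t; first by rewrite !subrr mulr0.
  have u0 : u - t < 0 by rewrite subr_lt0 lt_neqAle ut0.
  have := near (u - t); rewrite subrK lt_eqF // ltr0_norm // => /(_ isT).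
  move=> /(_ ltac:(lra)); rewrite ltr_norml => /andP[+ _].
  set q := _^-1 * _ => qe; have -> : F t - F u = q * (t - u).
    by rewrite -(opprB u t) mulrN /q mulrAC mulVf ?mul1r ?lt_eqF // opprB.
  by rewrite ler_pM2r; lra.
lra.
Qed.

Lemma sum_itv_le_measure (U : set R) (m : nat) (u v : 'I_m -> R) :
  measurable U -> (forall i, u i <= v i) ->
  (forall i, [set` `]u i, v i[] `<=` U) ->
  trivIset setT (fun i => [set` `]u i, v i[]) ->
  ((\sum_(i < m) (v i - u i))%:E <= lebesgue_measure U)%E.
Proof.
move=> mU uv uvU triv.
have mitv i : measurable [set` `]u i, v i[] by exact: measurable_itv.
have <- : lebesgue_measure (\big[setU/set0]_(i < m) [set` `]u i, v i[]) =
    (\sum_(i < m) (v i - u i))%:E.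
  rewrite measure_bigsetU_ord // -sumEFin; apply: eq_bigr => i _.
  apply: (etrans (lebesgue_measure_itv `]u i, v i[)); rewrite /= lte_fin EFinB.
  case: (ltP (u i)) => // vu.
  by rewrite (le_anti (introT andP (conj (uv i) vu))) -EFinB subrr.
apply: le_measure; rewrite ?inE //; first exact: bigsetU_measurable.
by apply: (big_ind (fun A => A `<=` U)) => // A B AU BU; rewrite subUset.
Qed.

(** Outer regularity of Lebesgue measure. *)
Lemma null_set_open_cover (N : set R) e :
  (@lebesgue_measure R).-negligible N -> 0 < e ->
  exists U : set R, [/\ open U, N `<=` U & (lebesgue_measure U <= e%:E)%E].
Proof.
move=> /negligible_outer_measure N0 e0.
have [U [oU NU Ue]] := outer_measure_open_le N e0.
by exists U; split=> //; rewrite N0 add0e in Ue.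
Qed.

(* The invariant P t bounds F t - F a by the slope e - r on [a, t], up to the
   increments of F over finitely many disjoint intervals inside an open set U
   of small measure that covers the exceptional null set; absolute continuity
   makes those increments small. *)
Lemma real_absolutely_continuous_decrease F a b r : a <= b -> 0 <= r ->
  real_absolutely_continuous a b F ->
  {ae (@lebesgue_measure R), forall t, a < t <= b ->
    exists2 df, is_derive t 1 F df & df <= - r} ->
  F b <= F a - r * (b - a).
Proof.
move=> ab r0 acF aeF; apply/ler_addgt0Pr => e0 e0_gt0.
(* The total error has three parts: [e * (b - a)] from the slopes, [e] from the increments of [F]
   inside [U], and [r * e] from the lengths of those intervals. *)
pose e := e0 / (b - a + 1 + r).
have e_gt0 : 0 < e by rewrite divr_gt0 //; lra.
have [d d_gt0 acFe] := acF _ e_gt0.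
(* The derivative bound is not assumed at [a], so [a] joins the exceptional set; every point of
   [[a, b]] outside [U] then has the bound. *)
have negN : (@lebesgue_measure R).-negligible (~` [set t | a < t <= b ->
    exists2 df, is_derive t 1 F df & df <= - r] `|` [set a]).
  apply: negligibleU => //; apply/negligibleP; first exact: measurable_set1.
  exact: lebesgue_measure_set1.
(* The half turns a measure bound [<=] into the strict [< d] of absolute continuity; [e] bounds the
   total length. *)
have de_gt0 : 0 < Num.min (d / 2) e by rewrite lt_min e_gt0 divr_gt0.
have [U [oU NU Ude]] := null_set_open_cover negN de_gt0.
pose P t := exists m (u v : nat -> R), [/\
  forall i, (i < m)%N ->
    [/\ a <= u i, u i <= v i, v i <= t & `[u i, v i] `<=` U],
  forall i j, (i < j < m)%N -> v i <= u j &
  (* The term [r * (v i - u i)] gives back the decrease that the slope [e - r] charges on intervals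
     where no derivative bound is used. *)
  F t - F a <= (e - r) * (t - a) +
    \sum_(i < m) (F (v i) - F (u i) + r * (v i - u i))].
have [m [u [v [uvm disj Fb]]]] : P b.
  apply: (real_induction ab).
    exists 0%N, (fun=> 0), (fun=> 0); split=> [//|i j /andP[_ //]|].
    by rewrite big_ord0 !subrr mulr0 addr0.
  (* Near a point of [U] the crossed interval lies in [U] and is appended to the list; elsewhere the
     straddle lemma bounds the increment and the list is kept. *)
  move=> t /andP[a_t tb]; have [Ut|Ut] := pselect (U t).
    have /nbhs_ballP[h /= h0 hU] : nbhs t U by exact: open_nbhs_nbhs.
    exists h => // u0 v0 au0 v0b tu0 u0t tv0 v0t [m [u [v [uvm disj Fu0]]]].
    exists m.+1, (fun i => if (i < m)%N then u i else u0),
      (fun i => if (i < m)%N then v i else v0); split=> [i|i j|].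
    - rewrite ltnS leq_eqVlt => /predU1P[->|im].
        rewrite ltnn; split=> //; first lra.
        move=> x /=; rewrite in_itv /= => /andP[ux xv]; apply: hU.
        rewrite -ball_normE /ball_ /= ltr_distlC; lra.
      by rewrite im; have [? ? ? ?] := uvm i im; split=> //; lra.
    - move=> /andP[ij]; rewrite ltnS leq_eqVlt => /predU1P[jm|jm].
        by rewrite jm ltnn -jm ij; rewrite jm in ij; have [_ _ + _] := uvm i ij.
      by rewrite jm (ltn_trans ij jm) disj // ij.
    - rewrite big_ord_recr /= ltnn.
      rewrite (eq_bigr (fun i : 'I_m => F (v i) - F (u i) + r * (v i - u i))).
        by have := mulr_ge0 (ltW e_gt0) (_ : 0 <= v0 - u0); lra.
      by move=> i _; rewrite ltn_ord.
  have [df Fdf dfr] : exists2 df, is_derive t 1 F df & df <= - r.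
    have [//|nFt] := pselect (exists2 df, is_derive t 1 F df & df <= - r).
    exfalso; apply: Ut; apply: NU; have [->|ta] := eqVneq t a; first by right.
    by left=> /= /(_ ltac:(by rewrite lt_neqAle eq_sym ta a_t)).
  have [h h0 Fh] := is_derive_straddle Fdf dfr e_gt0.
  exists h => // u0 v0 au0 v0b tu0 u0t tv0 v0t [m [u [v [uvm disj Fu0]]]].
  exists m, u, v; split=> // [i im|].
    by have [? ? ? ?] := uvm i im; split=> //; lra.
  have := Fh u0 v0 tu0 u0t tv0 v0t; lra.
have triv : trivIset setT (fun i : 'I_m => [set` `]u i, v i[]).
  move=> i j _ _ [x [/=]]; rewrite !in_itv /= => /andP[uix xvi] /andP[ujx xvj].
  apply/val_inj; case: (ltngtP i j) => // ij; exfalso.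
    by have := disj i j; rewrite ij ltn_ord => /(_ isT); lra.
  by have := disj j i; rewrite ij ltn_ord => /(_ isT); lra.
have len : \sum_(i < m) (v i - u i) <= Num.min (d / 2) e.
  rewrite -lee_fin; apply: le_trans Ude.
  apply: sum_itv_le_measure => // [|i|i x].
  - exact: open_measurable.
  - by have [] := uvm i (ltn_ord i).
  - move=> /=; rewrite in_itv /= => /andP[ux xv].
    have [_ _ _] := uvm i (ltn_ord i); apply.
    by rewrite /= in_itv /= !ltW.
have [lend lene] :
    \sum_(i < m) (v i - u i) < d /\ \sum_(i < m) (v i - u i) <= e.
  by move: len; rewrite le_min => /andP[? ?]; split=> //; lra.
have sumF : \sum_(i < m) (F (v i) - F (u i)) <= e.
  apply/ltW/(le_lt_trans _ (acFe m u v _ triv lend)) => [|i].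
    by apply: ler_sum => i _; exact: ler_norm.
  by have [] := uvm i (ltn_ord i).
have ee : e0 = e * (b - a + 1 + r) by rewrite /e mulfVK // gt_eqF //; lra.
move: Fb; rewrite big_split /= -mulr_sumr => Fb.
have := ler_wpM2l r0 lene; rewrite ee; lra.
Qed.

End absolutely_continuous_decrease.
(** Suppose [F t > c]. If [F] exceeds [c] on all of [(0, t]], then [F t <= B - r * t < 0],
    contradicting positivity. Otherwise [F] decreases from the supremum of the times in [[0, t]]
    with [F <= c], and continuity there is contradicted. *)
Lemma eventually_le_of_decrease (R : realType) (F : R -> R) (c r B : R) :
  0 < r -> F 0 <= B -> (forall t, 0 <= t -> 0 <= F t) ->
  (forall a b, 0 <= a -> a <= b -> real_absolutely_continuous a b F) ->
  {ae (@lebesgue_measure R), forall t, 0 <= t -> c < F t ->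
    exists2 df, is_derive t 1 F df & df <= - r} ->
  forall t, 0 <= t -> B < r * t -> F t <= c.
Proof.
move=> r0 F0B F_ge0 acF aeF t t0 Brt; rewrite leNgt; apply/negP => cFt.
have decr s : 0 <= s -> s <= t -> (forall x, s < x <= t -> c < F x) ->
    F t <= F s - r * (t - s).
  move=> s0 st cF.
  apply: real_absolutely_continuous_decrease (acF _ _ s0 st) _ => //.
    exact: ltW.
  apply: (filterS (Filter := ae_filter_ringOfSetsType _)) aeF.
  move=> x dFx /andP[sx xt]; apply: dFx; last by rewrite cF ?sx.
  exact: le_trans s0 (ltW sx).
pose A := [set s | 0 <= s <= t /\ F s <= c].
have [[s1 As1]|A0] := pselect (A !=set0); last first.
  have := decr 0 (lexx 0) t0; rewrite subr0.
  have Ft0 := F_ge0 t t0.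
  suff cF : forall x, 0 < x <= t -> c < F x by move=> /(_ cF); lra.
  move=> x /andP[x0 xt]; rewrite ltNge; apply/negP => Fxc.
  by apply: A0; exists x; split=> //; rewrite (ltW x0) xt.
have supA : has_sup A by split; [exists s1|exists t => s [/andP[]]].
have S0 : 0 <= sup A.
  by apply: le_trans (sup_ubound supA.2 As1); case: As1 => /andP[].
have St : sup A <= t by apply: sup_le_ub; [exists s1|move=> s [/andP[]]].
have FtS : F t <= F (sup A).
  have : F t <= F (sup A) - r * (t - sup A).
    apply: decr => // x /andP[Sx xt]; rewrite ltNge; apply/negP => Fxc.
    suff /(sup_ubound supA.2) : A x by lra.
    by split=> //; rewrite xt (le_trans S0 (ltW Sx)).
  have := mulr_ge0 (ltW r0) (_ : 0 <= t - sup A); lra.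
(* Absolute continuity on the single interval from [s] to [sup A] brings [F (sup A)] within
   [F t - c] of [F s <= c], so [F (sup A) < F t]. *)
have e0 : 0 < F t - c by rewrite subr_gt0.
have [d d0 acd] := acF _ _ (lexx 0) t0 _ e0.
have [s As sS] := sup_adherent d0 supA.
have sS' := sup_ubound supA.2 As; case: As => /andP[s0 st] Fsc.
have := acd 1%N (fun=> s) (fun=> sup A); rewrite !big_ord1.
have /[swap]/[apply] :
  forall i : 'I_1, 0 <= s /\ s <= sup A /\ sup A <= t by [].
have triv : trivIset setT (fun i : 'I_1 => [set` `]s, sup A[]).
  by move=> i j _ _ _; rewrite !ord1.
by move=> /(_ triv ltac:(lra)); rewrite ltr_norml => /andP[_ ?]; lra.
Qed.

(** * Squared distance between two solutions *)

Section sweeping.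
Variables (R : realType) (n : nat).
Implicit Types (x y : R -> 'rV[R]_n) (a b M : R).

Lemma dist_sqr_enorm (p q : 'rV[R]_n) :
  `|enorm p ^+ 2 - enorm q ^+ 2| <= enorm (p - q) * (enorm p + enorm q).
Proof.
have [p0 q0] := (enorm_ge0 p, enorm_ge0 q).
rewrite subr_sqr normrM (ger0_norm (addr_ge0 p0 q0)).
apply: ler_wpM2r; first exact: addr_ge0.
rewrite ler_norml lerNl opprB.
have := enormD (p - q) q; have := enormD (q - p) p.
by rewrite !subrK -[enorm (q - p)]enormN opprB => ? ?; apply/andP; split; lra.
Qed.

(** Squaring is Lipschitz on bounded sets: [enorm (x t - y t)] is at most [2 * M], so increments of
    the square are at most [4 * M] times those of [x - y]. *)
Lemma absolutely_continuous_sqr_enormB a b M x y : 0 < M ->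
  (forall t, a <= t <= b -> enorm (x t) <= M) ->
  (forall t, a <= t <= b -> enorm (y t) <= M) ->
  absolutely_continuous a b x -> absolutely_continuous a b y ->
  real_absolutely_continuous a b (fun t => enorm (x t - y t) ^+ 2).
Proof.
move=> M0 xM yM acx acy e e0.
have e'0 : 0 < e / (8 * M) by rewrite divr_gt0 ?mulr_gt0.
have [[d d0 acxd] [d' d'0 acyd]] := (acx _ e'0, acy _ e'0).
exists (Num.min d d'); first by rewrite lt_min d0.
move=> m u v uv triv; rewrite lt_min => /andP[/(acxd _ _ _ uv triv) sx].
move=> /(acyd _ _ _ uv triv) sy.
apply: (@le_lt_trans _ _ (\sum_(i < m) 4 * M *
  (enorm (x (v i) - x (u i)) + enorm (y (v i) - y (u i))))).
  apply: ler_sum => i _; apply: (le_trans (dist_sqr_enorm _ _)).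
  have [au [uv' vb]] := uv i.
  have xyM t : a <= t <= b -> enorm (x t - y t) <= 2 * M.
    move=> tab; have := enormB (x t) (y t).
    by have := xM t tab; have := yM t tab; lra.
  have := xyM (u i); have := xyM (v i).
  rewrite au vb (le_trans au uv') (le_trans uv' vb) => /(_ isT) vM /(_ isT) uM.
  rewrite mulrC; apply: ler_pM; rewrite ?addr_ge0 ?enorm_ge0 //; first lra.
  have -> : x (v i) - y (v i) - (x (u i) - y (u i)) =
    (x (v i) - x (u i)) - (y (v i) - y (u i)).
    by apply/rowP => j; rewrite !mxE; ring.
  exact: enormB.
rewrite -mulr_sumr big_split /=.
have -> : e = 4 * M * (e / (8 * M) + e / (8 * M)) by field; rewrite gt_eqF.
by rewrite ltr_pM2l ?mulr_gt0 // ltrD.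
Qed.

(** Each normal vector is tested against the base point of the other, and the two inequalities are
    added. *)
Lemma normal_cone_monotone (A : set 'rV[R]_n) (p q xi zeta : 'rV[R]_n) :
  normal_cone A p xi -> normal_cone A q zeta -> 0 <= dotp (xi - zeta) (p - q).
Proof.
move=> [Ap /(_ q) xiq] [Aq /(_ p) zetap].
have := xiq Aq; have := zetap Ap.
by rewrite !dotpE; lra.
Qed.

(** The normal cone terms contribute nonpositively. The rest splits through [h t (x t)]: strong
    monotonicity of [h] gives the [alpha] term, and Cauchy-Schwarz with [enorm (x t - y t) <= 2 * M]
    gives the [eta] term. *)
Lemma sweeping_sqr_enormB_derive (C : R -> set 'rV[R]_n)
    (g h : R -> 'rV[R]_n -> 'rV[R]_n)
    (x y : R -> 'rV[R]_n) (alpha eta M t : R) :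
  (forall c, C t c -> enorm c <= M) ->
  (forall p q, alpha * enorm (p - q) ^+ 2 <= dotp (h t p - h t q) (p - q)) ->
  (forall p, enorm (g t p - h t p) <= eta) ->
  derivable x t 1 ->
  [set xi + g t (x t) | xi in normal_cone (C t) (x t)] (- derive1 x t) ->
  derivable y t 1 ->
  [set xi + h t (y t) | xi in normal_cone (C t) (y t)] (- derive1 y t) ->
  exists2 df, is_derive t 1 (fun s => enorm (x s - y s) ^+ 2) df &
    df <= - (2 * alpha * enorm (x t - y t) ^+ 2 - 4 * M * eta).
Proof.
move=> CM hmon gh dx [xi Nxi xiE] dy [zeta Nzeta zetaE].
have dxy : derivable (x - y) t 1 by exact: derivableB.
exists (2 * dotp (derive1 (x - y) t) ((x - y) t)).
  exact: (is_derive_sqr_enorm dxy).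
rewrite derive1E deriveB // -!derive1E -[derive1 x t]opprK -xiE.
rewrite -[derive1 y t]opprK -zetaE.
have Nmon := normal_cone_monotone Nxi Nzeta.
have fmon := hmon (x t) (y t).
have [xM yM] : enorm (x t) <= M /\ enorm (y t) <= M.
  by split; apply: CM; [case: Nxi|case: Nzeta].
have ghd : - dotp (g t (x t) - h t (x t)) (x t - y t) <= 2 * M * eta.
  rewrite -dotpNl; apply: (le_trans (dotp_le _ _)); rewrite enormN mulrC.
  apply: ler_pM; rewrite ?enorm_ge0 //.
  by have := enormB (x t) (y t); lra.
rewrite -[(x - y) t]/(x t - y t); move: Nmon fmon ghd.
set D := x t - y t; rewrite !dotpE; lra.
Qed.

End sweeping.

Theorem theorem4p1 (R : realType) (n : nat) (eps0 : R)
  (f : R -> 'rV[R]_n -> R -> 'rV[R]_n) (C : R -> set 'rV[R]_n)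
  (Lf : R) (Lf_gt0 : 0 < Lf)
  (f_lipschitz : forall (t1 t2 : R) (x1 x2 : 'rV[R]_n) (eps : R),
    enorm (f t1 x1 eps - f t2 x2 eps)
      <= Lf * `|t1 - t2| + Lf * enorm (x1 - x2))
  (alpha : R) (alpha_gt0 : 0 < alpha)
  (f_monotone : forall (t : R) (x1 x2 : 'rV[R]_n),
    alpha * enorm (x1 - x2) ^+ 2
      <= dotp (f t x1 eps0 - f t x2 eps0) (x1 - x2))
  (C_nonempty : forall t : R, C t !=set0)
  (C_closed : forall t : R, closed (C t))
  (C_convex : forall t : R, convex_set (C t))
  (M : R) (M_gt0 : 0 < M)
  (C_bounded : forall (t : R) (c : 'rV[R]_n), C t c -> enorm c <= M)
  (LC : R) (LC_gt0 : 0 < LC)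
  (C_lipschitz : forall t1 t2 : R,
    (hausdorff_dist (C t1) (C t2) <= (LC * `|t1 - t2|)%:E)%E)
  (f_continuous_eps : forall eta : R, 0 < eta ->
    \forall eps \near eps0, forall (t : R) (x : 'rV[R]_n),
      enorm (f t x eps - f t x eps0) < eta)
  (x0 : R -> 'rV[R]_n)
  (x0_solution : sweeping_solution C (fun t x => f t x eps0) setT x0) :
  forall gamma : R, 0 < gamma ->
    exists2 t1 : R, 0 <= t1 &
      \forall eps \near eps0, forall xe : R -> 'rV[R]_n,
        sweeping_solution C (fun t x => f t x eps) `[0, +oo[ xe ->
        forall t : R, t1 <= t -> enorm (xe t - x0 t) < gamma.
Proof.
move=> gamma gamma0; pose r := alpha * gamma ^+ 2 / 2.
have g20 : 0 < gamma ^+ 2 by rewrite exprn_gt0.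
have r0 : 0 < r by rewrite divr_gt0 ?mulr_gt0.
(* This makes [4 * M * eta] equal to [r], while [2 * alpha * V] exceeds [2 * r] wherever V exceeds
   [gamma ^+ 2 / 2]. *)
pose eta := alpha * gamma ^+ 2 / (8 * M).
have eta0 : 0 < eta by rewrite divr_gt0 ?mulr_gt0.
have t1_ge0 : 0 <= 4 * M ^+ 2 / r + 1.
  by rewrite addr_ge0 // divr_ge0 ?mulr_ge0 ?sqr_ge0 ?ltW.
(* The time depends on neither [eps] nor [xe]; the added 1 makes [4 * M ^+ 2 < r * t] strict. *)
exists (4 * M ^+ 2 / r + 1) => //.
have [acx0 Cx0 aex0] := x0_solution.
apply: filterS (f_continuous_eps _ eta0) => eps feps xe [acxe Cxe aexe] t t1t.
have t0 : 0 <= t := le_trans t1_ge0 t1t.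
have in0y (s : R) : 0 <= s -> `[0, +oo[%classic s.
  by move=> s0; rewrite /= in_itv /= s0.
have CxeM (s : R) : 0 <= s -> enorm (xe s) <= M.
  by move=> s0; apply: (C_bounded s); apply: Cxe; exact: in0y.
have Cx0M s : enorm (x0 s) <= M by apply: (C_bounded s); exact: Cx0.
(* Half of [gamma ^+ 2] leaves room for the strict inequality. *)
suff Vt : enorm (xe t - x0 t) ^+ 2 <= gamma ^+ 2 / 2.
  by rewrite -(ltr_pXn2r (n := 2)) ?nnegrE ?enorm_ge0 ?ltW //; lra.
apply: (@eventually_le_of_decrease R (fun s => enorm (xe s - x0 s) ^+ 2)
  _ r (4 * M ^+ 2)) => //.
- have := enormB (xe 0) (x0 0); have := CxeM 0 (lexx 0); have := Cx0M 0.
  by have := enorm_ge0 (xe 0 - x0 0); nra.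
- by move=> s _; exact: sqr_ge0.
- move=> a b a0 ab; apply: (absolutely_continuous_sqr_enormB M_gt0).
  + by move=> s /andP[sa _]; apply: CxeM; exact: le_trans sa.
  + by [].
  + apply: acxe => // s; rewrite /= in_itv /= => /andP[sa _].
    exact/in0y/(le_trans a0 sa).
  + exact: acx0.
- apply: (@filterS2 _ _ (ae_filter_ringOfSetsType _) _ _ _ _ aexe aex0).
  move=> s /= dxe dx0 s0 cV; have [dxe1 dxe2] := dxe (in0y s s0).
  have [dx01 dx02] := dx0 I.
  have [df Fdf dfle] := @sweeping_sqr_enormB_derive R n C
    (fun t x => f t x eps) (fun t x => f t x eps0) xe x0 alpha eta M s
    (C_bounded s) (f_monotone s) (fun p => ltW (feps s p)) dxe1 dxe2 dx01 dx02.
  exists df => //; apply: (le_trans dfle); rewrite lerN2 /r.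
  have -> : 4 * M * eta = alpha * gamma ^+ 2 / 2.
    by rewrite /eta; field; rewrite gt_eqF.
  by have := ler_wpM2l (ltW alpha_gt0) (ltW cV); lra.
- have : r * (4 * M ^+ 2 / r + 1) <= r * t by rewrite ler_pM2l.
  by rewrite mulrDr mulr1 mulrC divfK ?gt_eqF //; lra.
Qed.
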